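(* Let $g:\mathbb{R}^2\times\mathbb{R}^2\to\mathbb{R}$ be a symmetric or anti-symmetric polynomial, let $G=(V,E)$ be a connected graph and let $D$ be a positive integer. Let $C\subset\mathbb{R}^2$ be an irreducible algebraic curve of degree at most $D$, and let $P\subset C$ be a finite set. If the restriction $g|_{C^2}$ is not constant, then $$\big|f_{g,G}(P^V)\big|\ge\left(\frac{1}{D\cdot\deg(g)}\left\lfloor\frac{|P|-D\cdot\deg(g)}{|V|}\right\rfloor\right)^{|V|-1}.$$ In particular, $\big|f_{g,G}(P^V)\big|\ge c|P|^{|V|-1}$ for some constant $c>0$ depending only on $G$, $g$ and $D$.
   Context: A graph is simple (no loops or multiple edges). Fix a total order on $V$; if $g$ is anti-symmetric, the endpoints of an edge are input to $g$ in increasing order. The measurement map is $f_{g,G}:(\mathbb{R}^2)^V\to\mathbb{R}^E$, $p\mapsto (g(p(v),p(w)))_{vw\in E}$.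
   Formalization: The finite set P is assumed nonempty: for P empty the stated bound fails, e.g. for a path on 3 vertices, C a line, g = x1 + x2 and D = 1 it would say 0 ≥ 1, and for |V| = 1 both claims fail. *)

(* Defs.v *)
From mathcomp Require Import all_boot all_order all_algebra.
From mathcomp Require Import finmap mpoly.
From mathcomp Require Import boolp classical_sets cardinality reals.
Set Implicit Arguments.
Unset Strict Implicit.
Unset Printing Implicit Defensive.
Import Order.TTheory GRing.Theory Num.Theory.
Local Open Scope ring_scope.

Definition simple_graph (V : finType) (adj : rel V) : Prop :=
  ssrbool.symmetric adj /\ irreflexive adj.

(* A connected graph has at least one vertex. *)
Definition connected_graph (V : finType) (adj : rel V) : Prop :=
  (0 < #|V|)%N /\ forall v w : V, connect adj v w.

(* An edge is stored as the pair of its endpoints in increasing order, so that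
   each unordered edge occurs exactly once. *)
Definition edge d (V : finOrderType d) (adj : rel V) : finType :=
  {vw : V * V | (vw.1 < vw.2)%O && adj vw.1 vw.2}.

(* Total degree; [msize] is one more than it, for a nonzero polynomial. *)
Definition mpdeg (R : realType) n (p : {mpoly R[n]}) : nat := (msize p).-1.

Definition eval2 (R : realType) (h : {mpoly R[2]}) (p : R * R) : R :=
  h.@[tnth [tuple p.1; p.2]].

Definition eval4 (R : realType) (g : {mpoly R[4]}) (p q : R * R) : R :=
  g.@[tnth [tuple p.1; p.2; q.1; q.2]].

Definition symmetric_poly (R : realType) (g : {mpoly R[4]}) : Prop :=
  forall p q : R * R, eval4 g p q = eval4 g q p.

Definition antisymmetric_poly (R : realType) (g : {mpoly R[4]}) : Prop :=
  forall p q : R * R, eval4 g p q = - eval4 g q p.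

Definition irreducible_mpoly (R : realType) n (h : {mpoly R[n]}) : Prop :=
  [/\ h != 0, h \isn't a GRing.unit &
      forall a b : {mpoly R[n]}, h = a * b ->
        (a \is a GRing.unit) \/ (b \is a GRing.unit)].

Definition zero_set (R : realType) (h : {mpoly R[2]}) : set (R * R) :=
  [set p | eval2 h p = 0]%classic.

(* [C] is infinite because a curve has dimension 1, whereas the real zero set
   of an irreducible polynomial (such as x ^ 2 + y ^ 2) may be finite.  For an
   infinite [C] the polynomial [h] is unique up to a nonzero scalar, so its
   degree is the degree of [C]. *)
Definition irreducible_curve_of_degree (R : realType) (C : set (R * R))
    (k : nat) : Prop :=
  infinite_set C /\
  exists h : {mpoly R[2]},
    [/\ irreducible_mpoly h, C = zero_set h & mpdeg h = k].

Definition constant_on_square (R : realType) (g : {mpoly R[4]})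
    (C : set (R * R)) : Prop :=
  exists k : R, forall p q : R * R, C p -> C q -> eval4 g p q = k.

Definition measurement (R : realType) d (V : finOrderType d) (adj : rel V)
    (g : {mpoly R[4]}) (p : V -> R * R) : {ffun edge adj -> R} :=
  [ffun vw : edge adj => eval4 g (p (val vw).1) (p (val vw).2)].

(* The image of P ^ V under the measurement map. *)
Definition measurement_image (R : realType) d (V : finOrderType d)
    (adj : rel V) (g : {mpoly R[4]}) (P : {fset R * R}) :
    {fset {ffun edge adj -> R}} :=
  [fset measurement adj g (fun v => val ((p : {ffun V -> P}) v))
    | p : {ffun V -> P}]%fset.

(* Main.v *)
(* For a point p of an irreducible curve C of degree at most D, the function
   g(p, .) is either constant on C or, by Bezout, takes each value at most
   b = D * deg g times on C.  If p and p' are both of the first kind, then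
   symmetry or antisymmetry forces g(p, q) = g(p', q) for every q in C; taking q
   of the second kind, Bezout shows that P has at most b points of the first
   kind.  Let P' be the set of the others.  Exploring G along a spanning tree and
   mapping vertices into P', each new vertex can be placed so as to give at least
   #|P'| / b distinct values on the edge that discovers it, whence at least
   (#|P'| / b) ^ (#|V| - 1) points in the image.  Since the points chosen for
   distinct vertices may coincide, P' need not be divided into #|V| parts.

   Bezout's bound for N common zeros of f and h, of degrees m and k and with no
   common factor, is a dimension count.  Let d(t) be the dimension of the space of
   polynomials in two variables of degree less than t, and let l_i be polynomials
   of degree less than N interpolating at the N points.  The linear map
   (a, b, c) |-> a * f + b * h + sum_i c_i * l_i with deg a < N + k, deg b < N + m
   lands in degree less than N + m + k, and its kernel consists of the
   (z * h, - z * f, 0) with deg z < N, so that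
   d(N + k) + d(N + m) + N <= d(N) + d(N + m + k), that is N <= k * m. *)
Require Import Defs.
From HB Require Import structures.
From mathcomp Require Import all_boot all_order all_algebra.
From mathcomp Require Import zify lra.
From mathcomp Require Import finmap mpoly.
From mathcomp Require Import boolp.
Import Order.TTheory GRing.Theory Num.Theory.
Local Open Scope ring_scope.

Set Implicit Arguments.
Unset Strict Implicit.
Unset Printing Implicit Defensive.

(** * Irreducible bivariate polynomials are prime *)

(** Stated over any unit ring, to be carried between [{mpoly K[2]}] and [{poly {poly K}}]; on the
    former it agrees with [irreducible_mpoly]. *)
Definition irreducible_elt (A : unitRingType) (h : A) : Prop :=
  [/\ h != 0, h \isn't a GRing.unit &
      forall a b : A, h = a * b -> a \is a GRing.unit \/ b \is a GRing.unit].

Lemma has_irreducible_factor (K : fieldType) (c : {poly K}) :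
  (1 < size c)%N -> exists2 p, irreducible_poly p & p %| c.
Proof.
elim: {c}_.+1 {-2}c (ltnSn (size c)) => // n IHn c lt_c c_gt1.
have [c_irr|c_nirr] := pselect (irreducible_poly c); first by exists c.
have [q [q_neq1 q_c /negP qNc]] :
    exists q : {poly K}, [/\ size q != 1%N, q %| c & ~ q %= c].
  apply: contrapT => noq; apply: c_nirr; split=> // q q1 qc.
  by apply: contrapT => qNc; apply: noq; exists q.
have c_neq0 : c != 0 by rewrite -size_poly_gt0 ltnW.
have q_neq0 : q != 0 by apply: contraNneq c_neq0 => q0; rewrite q0 dvd0p in q_c.
have lt_qc : (size q < size c)%N.
  by rewrite ltn_neqAle dvdp_leq // andbT dvdp_size_eqp.
have [||p p_irr p_q] := IHn q; first exact: leq_trans lt_qc _.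
  by rewrite ltn_neqAle eq_sym q_neq1 size_poly_gt0.
by exists p => //; apply: dvdp_trans p_q q_c.
Qed.

Lemma scale_dvdP (K : fieldType) (pi : {poly K}) (p : {poly {poly K}}) :
  (forall i, pi %| p`_i) -> exists p', p = pi *: p'.
Proof.
move=> pi_p; exists (\poly_(i < size p) (p`_i %/ pi)); apply/polyP=> i.
rewrite coefZ coef_poly; case: ltnP => [_|le_i]; last by rewrite nth_default ?mulr0.
by rewrite mulrC divpK.
Qed.

(** With i and j the least indices at which [pi] fails to divide the coefficients of [p] and [q],
    the coefficient of index i + j of [p * q] is p_i * q_j modulo [pi], hence nonzero. *)
Lemma irreducible_scale_prime (K : fieldType) (pi : {poly K})
    (p q r : {poly {poly K}}) :
  irreducible_poly pi -> pi *: r = p * q ->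
  (exists p', p = pi *: p') \/ (exists q', q = pi *: q').
Proof.
move=> pi_irr def_pq.
have [/scale_dvdP|nd_p] := pselect (forall i, pi %| p`_i); first by left.
have [/scale_dvdP|nd_q] := pselect (forall i, pi %| q`_i); first by right.
have ex_nd (s : {poly {poly K}}) :
    ~ (forall i, pi %| s`_i) -> exists i, ~~ (pi %| s`_i).
  by move=> /existsNP[i /negP]; exists i.
case: (ex_minnP (ex_nd _ nd_p)) => i nd_i min_i.
case: (ex_minnP (ex_nd _ nd_q)) => j nd_j min_j.
have : pi %| (p * q)`_(i + j) by rewrite -def_pq coefZ dvdp_mulr.
have lt_i : (i < (i + j).+1)%N by rewrite ltnS leq_addr.
rewrite coefM (bigD1 (Ordinal lt_i)) //= addKn dvdp_addl; last first.
  apply: (big_ind (fun s => pi %| s)) => [|x y|k]; [exact: dvdp0|exact: dvdp_add|].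
  rewrite -val_eqE /= => k_i; have [lt_ki|le_ik] := ltnP k i.
    by rewrite dvdp_mulr //; apply: contraTT lt_ki => /min_i; rewrite -leqNgt.
  rewrite dvdp_mull //; apply: contraTT (le_ik) => /min_j le_j.
  rewrite -ltnNge ltn_neqAle k_i /= -(leq_add2r j).
  by rewrite -leq_subRL // -ltnS.
have [|pi_cop] := boolP (pi %| p`_i); first by rewrite (negPf nd_i).
have : coprimep pi p`_i.
  have := dvdp_gcdl pi p`_i; rewrite coprimep_def; apply: contraTT => g1.
  apply/negP=> /(pi_irr.2 _ g1) g_pi; case/negP: pi_cop.
  by rewrite -(eqp_dvdl _ g_pi) dvdp_gcdr.
by move=> /Gauss_dvdpr->; rewrite (negPf nd_j).
Qed.

Lemma scaler_polyI (K : fieldType) (c : {poly K}) (p q : {poly {poly K}}) :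
  c != 0 -> c *: p = c *: q -> p = q.
Proof.
by move=> c0 /polyP e; apply/polyP=> i; have := e i; rewrite !coefZ => /(mulfI c0).
Qed.

(* Gauss's lemma: a factorization over K(x) descends to K[x]. *)
Lemma factor_scaled (K : fieldType) (c : {poly K}) (a b h : {poly {poly K}}) :
  c != 0 -> c *: h = a * b ->
  exists d e a' b', [/\ c = d * e, a = d *: a', b = e *: b' & h = a' * b'].
Proof.
elim: {c}_.+1 {-2}c (ltnSn (size c)) a b => // n IHn c lt_c a b c0 def_ab.
(* A unit [c] is absorbed into [a]; otherwise an irreducible factor of [c] divides [a] or [b] and is
   cancelled. *)
have [c_le1|c_gt1] := leqP (size c) 1.
  have cU : c \is a GRing.unit.
    have c1 : size c == 1%N by rewrite eqn_leq c_le1 size_poly_gt0.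
    rewrite poly_unitE c1 unitfE -lead_coef_eq0 in c0 *.
    by rewrite lead_coefE (eqP c1) in c0.
  exists c, 1, (c^-1 *: a), b; split; rewrite ?mulr1 ?scale1r //.
    by rewrite scalerA divrr // scale1r.
  by rewrite -scalerAl -def_ab scalerA mulVr // scale1r.
have [p p_irr /dvdpP[c1 def_c]] := has_irreducible_factor c_gt1.
have p0 : p != 0 by apply: irredp_neq0.
have c10 : c1 != 0 by apply: contraNneq c0 => c10; rewrite def_c c10 mul0r.
have lt_c1 : (size c1 < n)%N.
  rewrite -ltnS; apply: leq_trans lt_c; rewrite def_c size_mul // ltnS.
  have := p_irr.1; case: (size p) => // -[|m] // _.
  by rewrite !addnS /= -addSn leq_addr.
rewrite def_c [c1 * p]mulrC -scalerA in def_ab *.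
have [[a1 def_a]|[b1 def_b]] := irreducible_scale_prime p_irr def_ab.
  move: def_ab; rewrite def_a -scalerAl => /(scaler_polyI p0) /(IHn _ lt_c1).
  case=> // d [e [a' [b' [-> -> -> ->]]]]; exists (p * d), e, a', b'.
  by rewrite scalerA mulrA.
move: def_ab; rewrite def_b -scalerAr => /(scaler_polyI p0) /(IHn _ lt_c1).
case=> // d [e [a' [b' [-> -> -> ->]]]]; exists d, (p * e), a', b'.
by rewrite scalerA mulrCA.
Qed.

(** Gauss's lemma writes h as e *: h', where h' has the same positive degree in the outer variable;
    so irreducibility makes e a unit, and the denominator [c] disappears. *)
Lemma irreducible_scaled_dvd (K : fieldType) (h a q : {poly {poly K}})
    (c : {poly K}) :
  irreducible_elt h -> (1 < size h)%N -> c != 0 -> c *: a = q * h ->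
  exists s, a = s * h.
Proof.
move=> [h0 hNU h_irr] h_gt1 c0 /(factor_scaled c0)[d [e [q' [h' [_ _ def_h ->]]]]].
have e0 : e != 0 by apply: contraNneq h0 => e0; rewrite def_h e0 scale0r.
have [|eU|h'U] := h_irr e%:P h'; first by rewrite mul_polyC.
  move: eU; rewrite poly_unitE coefC => /andP[_ eU].
  exists (e^-1 *: q'); rewrite def_h -scalerAl -scalerAr scalerA.
  by rewrite mulVr // scale1r.
by move: h'U h_gt1; rewrite def_h size_scale // poly_unitE => /andP[/eqP->].
Qed.

(** An [h] constant in the outer variable is an irreducible element of K[x], handled
    coefficientwise. Otherwise divisibility is settled over K(x) and brought back by
    [irreducible_scaled_dvd]. *)
Lemma irreducible_bipoly_prime (K : fieldType) (h a f r : {poly {poly K}}) :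
  irreducible_elt h -> a * f = r * h ->
  (exists s, a = s * h) \/ (exists s, f = s * h).
Proof.
move=> h_irr def_af; have [h0 hNU h_fact] := h_irr.
have [h_le1|h_gt1] := leqP (size h) 1.
  have [pi def_h] : exists pi, h = pi%:P by exists h`_0; apply: size1_polyC.
  have pi0 : pi != 0 by apply: contraNneq h0 => pi0; rewrite def_h pi0.
  have unitC (x : {poly K}) : (x%:P \is a GRing.unit) = (size x == 1%N).
    rewrite poly_unitE size_polyC coefC /= poly_unitE.
    have [-> |x0] := eqVneq x 0; first by rewrite size_poly0.
    rewrite /=; have [|] := eqVneq (size x) 1%N => // s1.
    by rewrite unitfE; move: x0; rewrite -lead_coef_eq0 lead_coefE s1.
  have pi_irr : irreducible_poly pi.
    split=> [|q q1 /dvdpP[s def_pi]].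
      by rewrite ltn_neqAle eq_sym -unitC -def_h hNU size_poly_gt0.
    have [|sU|qU] := h_fact s%:P q%:P; first by rewrite -polyCM -def_pi.
      move: sU; rewrite unitC => /size_poly1P[k k0 def_s].
      by rewrite def_pi def_s mul_polyC eqp_sym eqp_scale.
    by rewrite unitC (negPf q1) in qU.
  have [||[s ->]|[s ->]] := @irreducible_scale_prime _ pi a f r.
  - exact: pi_irr.
  - by rewrite def_af def_h mulrC mul_polyC.
  - by left; exists s; rewrite def_h mulrC mul_polyC.
  - by right; exists s; rewrite def_h mulrC mul_polyC.
have [cop|ncop] := boolP (coprimep h f).
  have : h %| a.
    by rewrite -(Gauss_dvdpl _ cop) def_af
       dvdp_mull.
  move/Pdiv.Idomain.dvdpP=> [[c q] /= c0 def_a].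
  by left; apply: irreducible_scaled_dvd def_a.
(* Here [%|] means divisibility up to a nonzero scalar in K[x]. By irreducibility the gcd is, up to
   scalars, trivial or [h] itself, and [ncop] excludes the former. *)
right; set e := gcdp h f.
have /Pdiv.Idomain.dvdpP[[c q] /= c0 def_h] : e %| h.
  exact: dvdp_gcdl.
have /Pdiv.Idomain.dvdpP[[c' u] /= c'0 def_f] : e %| f.
  exact: dvdp_gcdr.
have [d [e2 [q' [e' [def_c def_q def_e def_h']]]]] := factor_scaled c0 def_h.
have e20 : e2 != 0 by apply: contraNneq c0 => e0; rewrite def_c e0 mulr0.
have [q'U|e'U] := h_fact _ _ def_h'; last first.
  case/negP: ncop; rewrite coprimep_def -/e def_e size_scale //.
  by move: e'U; rewrite poly_unitE => /andP[].
apply: (@irreducible_scaled_dvd _ _ _ (e2 *: (u * q'^-1)) _ h_irr h_gt1 c'0).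
by rewrite def_f def_e def_h' -scalerAl -scalerAr mulrA mulrVK.
Qed.

(** * The isomorphism of K[x, y] with K[x][y] *)

Section BivariateIso.
Variable K : fieldType.

Definition bipoly_of_mpoly : {rmorphism {mpoly K[2]} -> {poly {poly K}}} :=
  mmap (polyC \o polyC) (tnth [tuple 'X%:P; 'X]).

Definition mpoly_of_poly : {rmorphism {poly K} -> {mpoly K[2]}} :=
  horner_eval ('X_ord0 : {mpoly K[2]}) \o map_poly (@mpolyC 2 K).

Definition mpoly_of_bipoly : {rmorphism {poly {poly K}} -> {mpoly K[2]}} :=
  horner_eval ('X_ord_max : {mpoly K[2]}) \o map_poly mpoly_of_poly.

Lemma bipoly_of_mpolyX0 : bipoly_of_mpoly 'X_ord0 = 'X%:P.
Proof. by rewrite /bipoly_of_mpoly /= mmapX mmap1U. Qed.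

Lemma bipoly_of_mpolyX1 : bipoly_of_mpoly 'X_ord_max = 'X.
Proof. by rewrite /bipoly_of_mpoly /= mmapX mmap1U. Qed.

Lemma mpoly_of_polyC k : mpoly_of_poly k%:P = k%:MP.
Proof. by rewrite /mpoly_of_poly /= /horner_eval map_polyC hornerC. Qed.

Lemma mpoly_of_polyX : mpoly_of_poly 'X = 'X_ord0.
Proof. by rewrite /mpoly_of_poly /= /horner_eval map_polyX hornerX. Qed.

Lemma mpoly_of_bipolyC c : mpoly_of_bipoly c%:P = mpoly_of_poly c.
Proof.
by rewrite -[LHS]/((map_poly mpoly_of_poly c%:P).['X_ord_max]) map_polyC hornerC.
Qed.

Lemma mpoly_of_bipolyX : mpoly_of_bipoly 'X = 'X_ord_max.
Proof.
by rewrite -[LHS]/((map_poly mpoly_of_poly 'X).['X_ord_max]) map_polyX hornerX.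
Qed.

Lemma bipoly_of_mpolyK : cancel bipoly_of_mpoly mpoly_of_bipoly.
Proof.
move=> p; rewrite {1}[p]mpolyE [RHS]mpolyE (rmorph_sum bipoly_of_mpoly).
rewrite (rmorph_sum mpoly_of_bipoly).
apply: eq_bigr => m _.
rewrite -mul_mpolyC (rmorphM bipoly_of_mpoly) (rmorphM mpoly_of_bipoly).
rewrite [X in mpoly_of_bipoly X * _]mmapC.
rewrite mpoly_of_bipolyC mpoly_of_polyC; congr (_ * _).
rewrite [in LHS]mpolyXE_id [in RHS]mpolyXE_id (rmorph_prod bipoly_of_mpoly).
rewrite (rmorph_prod mpoly_of_bipoly); apply: eq_bigr => i _.
rewrite !rmorphXn; congr (_ ^+ _).
have [->|->] : i = ord0 \/ i = ord_max.
- by case: i => [[|[|//]] lt_i]; [left|right]; apply: val_inj.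
- by rewrite bipoly_of_mpolyX0 mpoly_of_bipolyC mpoly_of_polyX.
- by rewrite bipoly_of_mpolyX1 mpoly_of_bipolyX.
Qed.

Lemma mpoly_of_bipolyK : cancel mpoly_of_bipoly bipoly_of_mpoly.
Proof.
have polyK c : bipoly_of_mpoly (mpoly_of_poly c) = c%:P.
  elim/poly_ind: c => [|c a IHc]; first by rewrite !rmorph0.
  rewrite polyCD polyCM !(rmorphD, rmorphM) IHc.
  rewrite mpoly_of_polyX mpoly_of_polyC bipoly_of_mpolyX0.
  by congr (_ + _); apply: mmapC.
elim/poly_ind => [|q c IHq]; first by rewrite !rmorph0.
rewrite !(rmorphD, rmorphM) IHq.
rewrite mpoly_of_bipolyX mpoly_of_bipolyC polyK.
by rewrite bipoly_of_mpolyX1.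
Qed.

Lemma irreducible_mpoly_prime (h a f r : {mpoly K[2]}) :
  irreducible_elt h -> a * f = r * h ->
  (exists s, a = s * h) \/ (exists s, f = s * h).
Proof.
move=> [h0 hNU h_fact] def_af.
have unit_to (x : {mpoly K[2]}) :
    (bipoly_of_mpoly x \is a GRing.unit) = (x \is a GRing.unit).
  apply/idP/idP=> xU; last exact: rmorph_unit.
  by rewrite -(bipoly_of_mpolyK x) rmorph_unit.
have from_dvd x : (exists s, bipoly_of_mpoly x = s * bipoly_of_mpoly h) ->
    exists s, x = s * h.
  case=> s def_x; exists (mpoly_of_bipoly s); apply: (can_inj bipoly_of_mpolyK).
  by rewrite (rmorphM bipoly_of_mpoly) mpoly_of_bipolyK.
have h_irr : irreducible_elt (bipoly_of_mpoly h).
  split; rewrite ?unit_to //.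
    by rewrite -(inj_eq (can_inj bipoly_of_mpolyK)) rmorph0 in h0.
  move=> u v def_h; rewrite -(mpoly_of_bipolyK u) -(mpoly_of_bipolyK v) !unit_to.
  by apply: h_fact; rewrite -(rmorphM mpoly_of_bipoly) -def_h bipoly_of_mpolyK.
have [|/from_dvd|/from_dvd] := @irreducible_bipoly_prime K (bipoly_of_mpoly h)
    (bipoly_of_mpoly a) (bipoly_of_mpoly f) (bipoly_of_mpoly r) h_irr.
- by rewrite -!(rmorphM bipoly_of_mpoly) def_af.
- by left.
- by right.
Qed.

End BivariateIso.

(** * Bezout's bound *)

(** Passing from t to t + 1 adds the t + 1 monomials x^i * y^(t - i). Doubling avoids a division. *)
Lemma card_bmultinom2 t : (#|{: 'X_{1..2 < t}}|.*2 = t * t.+1)%N.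
Proof.
elim: t => [|t IHt].
  by apply/eqP; rewrite double_eq0 -leqn0 leqNgt; apply/card_gt0P => -[[m]].
pose f (x : 'X_{1..2 < t} + 'I_t.+1) : 'X_{1..2} :=
  match x with inl m => m | inr i => [multinom of [tuple val i; t - i]] end%N.
have deg2 (m : 'X_{1..2}) : mdeg m = (m ord0 + m ord_max)%N.
  by rewrite mdegE !big_ord_recl big_ord0 addn0; congr (_ + m _)%N; apply/val_inj.
have f_deg x : (mdeg (f x) < t.+1)%N.
  case: x => [m|i] /=; first exact: leq_trans (bmdeg m) _.
  by rewrite deg2 !multinomE !(tnth_nth 0%N) /= subnKC // -ltnS.
pose F x : 'X_{1..2 < t.+1} := BMultinom (f_deg x).
have F_inj : injective F.
  move=> [m|i] [m'|i'] /(congr1 val) /= e.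
  - by congr inl; apply: val_inj.
  - have := bmdeg m; rewrite e deg2 !multinomE !(tnth_nth 0%N) /= subnKC ?ltnn //.
    by rewrite -ltnS.
  - have := bmdeg m'; rewrite -e deg2 !multinomE !(tnth_nth 0%N) /= subnKC ?ltnn //.
    by rewrite -ltnS.
  - congr inr; apply: val_inj; move/mnmP/(_ ord0): e.
    by rewrite !multinomE !(tnth_nth 0%N).
have F_surj m : m \in codom F.
  have [lt_m|le_m] := ltnP (mdeg m) t.
    by apply/codomP; exists (inl (BMultinom lt_m)); apply: val_inj.
  have mE : (m ord0 + m ord_max = t)%N.
    by apply/eqP; rewrite -deg2 eqn_leq le_m andbT -ltnS bmdeg.
  have lt_m0 : (m ord0 < t.+1)%N by move: mE; lia.
  apply/codomP; exists (inr (Ordinal lt_m0)); apply: val_inj; apply/mnmP => i /=.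
  rewrite multinomE (tnth_nth 0%N) /=; case: i => [[|[|//]] lt_i] /=.
    by congr (m _); apply: val_inj.
  have -> : (t - m ord0 = m ord_max)%N by move: mE; lia.
  by congr (m _); apply: val_inj.
have <- : #|codom F| = #|{: 'X_{1..2 < t.+1}}|.
  by apply: eq_card => m; rewrite F_surj.
rewrite card_codom // card_sum card_ord doubleD IHt; lia.
Qed.

(** Rank-nullity: the rank of [L] is at most [dim rT], and its kernel, covered by [Z], has dimension
    at most [dim zT]. *)
Lemma dim_le_ker (K : fieldType) (aT rT zT : vectType K)
    (L : {linear aT -> rT}) (Z : {linear zT -> aT}) :
  (forall u, L u = 0 -> exists z, u = Z z) -> (dim aT <= dim zT + dim rT)%N.
Proof.
move=> kerL; rewrite -!dimvf -(limg_ker_dim (linfun L) fullv) capfv.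
apply: leq_add; last exact: dimvS (subvf _).
apply: (@leq_trans (\dim (limg (linfun Z)))); last first.
  by rewrite -(limg_ker_dim (linfun Z) fullv) leq_addl.
apply/dimvS/subvP => u; rewrite memv_ker lfunE => /eqP/kerL[z ->].
by rewrite -lfunE memv_img // memvf.
Qed.

Section CommonZeros.
Variable K : fieldType.
Implicit Types (p : K * K) (f h : {mpoly K[2]}).

Notation ev p f := (f.@[tnth [tuple p.1; p.2]]).

Lemma msizeM_leq f h m k : (msize f <= m)%N -> (msize h <= k.+1)%N ->
  (msize (f * h) <= m + k)%N.
Proof.
move=> fm hk; have [->|f0] := eqVneq f 0; first by rewrite mul0r msize0.
have [->|h0] := eqVneq h 0; first by rewrite mulr0 msize0.
by rewrite msizeM //; move: (msize f) (msize h) fm hk; lia.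
Qed.

(** A product of lines parallel to the axes, one through each point of [s], all avoiding [p]. *)
Lemma separating_poly (s : seq (K * K)) p :
  p \notin s -> exists2 l : {mpoly K[2]}, (msize l <= (size s).+1)%N &
    ev p l != 0 /\ forall q, q \in s -> ev q l = 0.
Proof.
elim: s => [_|q s IHs]; first by exists 1; rewrite ?msize1 ?rmorph1 ?oner_eq0.
rewrite inE negb_or => /andP[p_q /IHs[l l_size [lp ls]]].
pose lin (i : 'I_2) (c : K) : {mpoly K[2]} := 'X_i - c%:MP.
have lin_size i c : (msize (lin i c) <= 2)%N.
  rewrite (leq_trans (msizeD_le _ _)) // geq_max msizeN msizeX msizeC mdeg1.
  by case: (c != 0).
have size_lin i c : (msize (lin i c * l) <= (size (q :: s)).+1)%N.
  by rewrite mulrC /= -[(size s).+2]addn1 msizeM_leq.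
have ev_lin i c r : ev r (lin i c) = tnth [tuple r.1; r.2] i - c.
  by rewrite mevalB mevalXU mevalC.
have [q1|q1] := eqVneq p.1 q.1.
  have q2 : p.2 != q.2.
    by apply: contraNneq p_q; move: q1; case: (p) (q) => ? ? [? ?] /= -> ->.
  exists (lin ord_max q.2 * l) => //; split.
    by rewrite mevalM mulf_neq0 // ev_lin subr_eq0.
  move=> r; rewrite inE mevalM => /orP[/eqP->|/ls->]; last by rewrite mulr0.
  by rewrite ev_lin subrr mul0r.
exists (lin ord0 q.1 * l) => //; split.
  by rewrite mevalM mulf_neq0 // ev_lin subr_eq0.
move=> r; rewrite inE mevalM => /orP[/eqP->|/ls->]; last by rewrite mulr0.
by rewrite ev_lin subrr mul0r.
Qed.

(** Coefficient vectors stand for the polynomials of degree less than t because they form a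
    [vectType] whose dimension counts monomials. *)
Definition bpoly t (v : {ffun 'X_{1..2 < t} -> K^o}) : {mpoly K[2]} :=
  \sum_m (v m : K) *: 'X_[m].

Lemma bpoly_is_linear t : linear (@bpoly t).
Proof.
move=> c u v; rewrite /bpoly scaler_sumr -big_split /=; apply: eq_bigr => m _.
by rewrite !ffunE scalerDl scalerA.
Qed.

HB.instance Definition _ t :=
  GRing.isLinear.Build _ _ _ _ (@bpoly t) (@bpoly_is_linear t).

(** Truncation makes this linear on all polynomials; it inverts [bpoly] in degree less than t. *)
Definition bcoef t f : {ffun 'X_{1..2 < t} -> K^o} :=
  [ffun m : 'X_{1..2 < t} => f@_m].

Lemma bcoef_is_linear t : linear (@bcoef t).
Proof. by move=> c u v; apply/ffunP=> m; rewrite !ffunE mcoeffD mcoeffZ. Qed.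

HB.instance Definition _ t :=
  GRing.isLinear.Build _ _ _ _ (@bcoef t) (@bcoef_is_linear t).

Lemma bcoefK t f : (msize f <= t)%N -> bpoly (bcoef t f) = f.
Proof.
move=> /mpolywE {2}->; apply: eq_bigr => m _; by rewrite ffunE.
Qed.

Lemma msize_bpoly t (v : {ffun 'X_{1..2 < t} -> K^o}) : (msize (bpoly v) <= t)%N.
Proof.
rewrite (leq_trans (msize_sum _ _ _)) //; apply/bigmax_leqP => m _.
by rewrite (leq_trans (msizeZ_le _ _)) // msizeX bmdeg.
Qed.

Lemma bpolyK t : cancel (@bpoly t) (@bcoef t).
Proof.
move=> v; apply/ffunP => m; rewrite ffunE /bpoly raddf_sum (bigD1 m) //=.
rewrite mcoeffZ mcoeffX eqxx mulr1 big1 ?addr0 // => m' m'm.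
by rewrite mcoeffZ mcoeffX -bmeqP (negPf m'm) mulr0.
Qed.


(** Leaving out the i-th point leaves one line fewer than [size s], whence the strict bound on the
    degree. *)
Lemma interpolation_polys (s : seq (K * K)) : uniq s ->
  exists l : 'I_(size s) -> {mpoly K[2]}, forall i,
    [/\ (msize (l i) <= size s)%N, ev (tnth (in_tuple s) i) (l i) != 0 &
        forall j, j != i -> ev (tnth (in_tuple s) j) (l i) = 0].
Proof.
move=> s_uniq; apply: (@fin_all_exists _ _ (fun i (l : {mpoly K[2]}) =>
  [/\ (msize l <= size s)%N, ev (tnth (in_tuple s) i) l != 0 &
      forall j, j != i -> ev (tnth (in_tuple s) j) l = 0])) => i.
set p := tnth _ i; have p_s : p \in s by exact: mem_tnth.
have [|l] := @separating_poly (rem p s) p; first by rewrite mem_rem_uniq // inE eqxx.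
rewrite size_rem // prednK; last by case: (s) p_s.
move=> l_size [lp ls]; exists l; split=> // j j_i; apply: ls.
rewrite mem_rem_uniq // inE /= mem_tnth andbT.
apply: contra_neq j_i; rewrite /p !(tnth_nth p) /= => /eqP.
by rewrite nth_uniq // => /eqP/val_inj.
Qed.

(** The lack of a common factor is expressed in the form that the kernel computation consumes and
    that primality of [h] provides. *)
Lemma common_zeros_bound f h (s : seq (K * K)) k m :
    uniq s -> msize h = k.+1 -> (msize f <= m.+1)%N ->
    (forall a b, a * f = b * h -> exists z, a = z * h) ->
    (forall p, p \in s -> ev p f = 0 /\ ev p h = 0) ->
  (size s <= k * m)%N.
Proof.
move=> s_uniq h_size f_size fh_cop fh_s.
have h0 : h != 0 by rewrite -msize_poly_eq0 h_size.
have [l l_interp] := interpolation_polys s_uniq.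
set N := size s in l l_interp *; set t := (N + m + k)%N.
pose aT := ({ffun 'X_{1..2 < N + k} -> K^o} * {ffun 'X_{1..2 < N + m} -> K^o}
            * {ffun 'I_N -> K^o})%type.
pose G (u : aT) : {mpoly K[2]} :=
  bpoly u.1.1 * f + bpoly u.1.2 * h + \sum_i (u.2 i : K) *: l i.
have G_size u : (msize (G u) <= t)%N.
  rewrite (leq_trans (msizeD_le _ _)) // geq_max; apply/andP; split.
    rewrite (leq_trans (msizeD_le _ _)) // geq_max; apply/andP; split.
      by rewrite /t addnAC msizeM_leq ?msize_bpoly.
    by rewrite msizeM_leq ?msize_bpoly ?h_size.
  rewrite (leq_trans (msize_sum _ _ _)) //; apply/bigmax_leqP => i _.
  rewrite (leq_trans (msizeZ_le _ _)) //; have [l_le _ _] := l_interp i.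
  by rewrite (leq_trans l_le) // /t -addnA leq_addr.
have G_linear : linear G.
  move=> c u v; rewrite /G /= !linearP /= !mulrDl !scalerDr -!scalerAl.
  rewrite [X in _ + X = _](_ : _ =
    c *: (\sum_i (u.2 i : K) *: l i) + \sum_i (v.2 i : K) *: l i).
    by rewrite [RHS]addrACA; congr (_ + _); rewrite [RHS]addrACA.
  rewrite scaler_sumr -big_split; apply: eq_bigr => i _ /=.
  by rewrite !ffunE scalerDl scalerA.
pose L u := bcoef t (G u).
have L_linear : linear L by move=> c u v; rewrite /L G_linear linearP.
pose Z (z : {ffun 'X_{1..2 < N} -> K^o}) : aT :=
  (bcoef (N + k) (bpoly z * h), bcoef (N + m) (- (bpoly z * f)), 0).
have Z_linear : linear Z.
  move=> c u v; rewrite /Z; congr (_, _, _).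
  - by rewrite linearP /= mulrDl -scalerAl linearP.
  - by rewrite linearP /= mulrDl -scalerAl opprD -scalerN linearP.
  - by rewrite /= scaler0 addr0.
pose Llin : {linear aT -> {ffun 'X_{1..2 < t} -> K^o}} :=
  HB.pack L (GRing.isLinear.Build _ _ _ _ L L_linear).
pose Zlin : {linear {ffun 'X_{1..2 < N} -> K^o} -> aT} :=
  HB.pack Z (GRing.isLinear.Build _ _ _ _ Z Z_linear).
have kerL u : L u = 0 -> exists z, u = Z z.
  move=> Lu; have Gu : G u = 0.
    by rewrite -(bcoefK (G_size u)) -[bcoef _ _]/(L u) Lu linear0.
  (* At the j-th point [f], [h] and every [l i] with i != j vanish, which isolates the j-th
     coefficient. *)
  have u2 : u.2 = 0.
    apply/ffunP=> j; rewrite ffunE; have [_ lj _] := l_interp j.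
    have p_s : tnth (in_tuple s) j \in s by exact: mem_tnth.
    have [fp hp] := fh_s _ p_s.
    have := congr1 (fun g : {mpoly K[2]} => ev (tnth (in_tuple s) j) g) Gu.
    rewrite /G !mevalD !mevalM fp hp !mulr0 !add0r raddf_sum meval0 (bigD1 j) //=.
    rewrite big1 => [|i i_j]; last first.
      by have [_ _ li] := l_interp i; rewrite mevalZ li ?mulr0 // eq_sym.
    by rewrite addr0 mevalZ => /eqP; rewrite mulf_eq0 (negPf lj) orbF => /eqP.
  move: Gu; rewrite /G u2 big1 ?addr0 => [|i _]; last by rewrite ffunE scale0r.
  move=> Gu; have def_af : bpoly u.1.1 * f = - bpoly u.1.2 * h.
    by apply/eqP; rewrite mulNr -addr_eq0 Gu.
  have [z def_a] := fh_cop _ _ def_af.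
  (* The degree of [h] is exactly k, and that of z * h is less than N + k. *)
  have z_size : (msize z <= N)%N.
    have [->|z0] := eqVneq z 0; first by rewrite msize0.
    have := msize_bpoly u.1.1; rewrite def_a msizeM // h_size addnS /=.
    by rewrite leq_add2r.
  have def_b : bpoly u.1.2 = - (z * f).
    apply: (mulIf h0); apply/eqP; rewrite -eqr_opp -!mulNr -def_af def_a opprK.
    by rewrite mulrAC.
  exists (bcoef N z); rewrite /Z bcoefK // -def_a -def_b !bpolyK -u2.
  by case: (u) => [[]].
(* The factors 1 are the dimension of [K^o]. As 2 d(t) = t (t + 1), the inequality simplifies to N
   <= k m. *)
have : (#|{: 'X_{1..2 < N + k}}| * 1 + #|{: 'X_{1..2 < N + m}}| * 1 + #|'I_N| * 1
        <= #|{: 'X_{1..2 < N}}| * 1 + #|{: 'X_{1..2 < t}}| * 1)%N.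
  exact: (@dim_le_ker K _ _ _ Llin Zlin kerL).
rewrite card_ord !muln1.
have := card_bmultinom2 (N + k); have := card_bmultinom2 (N + m).
have := card_bmultinom2 N; have := card_bmultinom2 t.
rewrite /t; do 4!move: #|_| => ?; nia.
Qed.

End CommonZeros.

(** * Counting assignments along a connected graph *)

(** Greedy choice: keep one point, discard the at most [b] points of its fibre, and repeat. *)
Lemma injective_on_subset (X : finType) (Y : eqType) (phi : X -> Y) (A : {set X})
    (b : nat) :
  (forall c, #|[set x in A | phi x == c]| <= b)%N ->
  exists2 B : {set X}, B \subset A &
    {in B &, injective phi} /\ (#|A| <= b * #|B|)%N.
Proof.
elim: {A}_.+1 {-2}A (ltnSn #|A|) => // n IHn A lt_A fib_le.
have [->|[x xA]] := set_0Vmem A.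
  by exists set0 => //; split; [move=> x y; rewrite inE|rewrite cards0].
pose F := [set y in A | phi y == phi x].
have xF : x \in F by rewrite inE xA eqxx.
have FA : F \subset A by apply/subsetP => y; rewrite inE => /andP[].
have cardA : (#|A| = #|F| + #|A :\: F|)%N.
  by rewrite -(cardsID F A) (setIidPr FA).
have F_gt0 : (0 < #|F|)%N by apply/card_gt0P; exists x.
have [||B BA [phi_inj le_B]] := IHn (A :\: F).
- by move: lt_A F_gt0; rewrite cardA; lia.
- move=> c; apply: leq_trans (fib_le c); apply/subset_leq_card/subsetP => y.
  by rewrite !inE => /andP[/andP[_ ->] ->].
have BF y : y \in B -> (y \in A) && (phi y != phi x).
  by move=> /(subsetP BA); rewrite !inE; case: (y \in A); rewrite ?andbT ?andbF ?andTb.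
have xB : x \notin B by apply/negP => /BF; rewrite eqxx andbF.
exists (x |: B).
  by apply/subsetP => y; rewrite !inE => /predU1P[->|/BF/andP[]].
split; last by rewrite cardsU1 xB cardA mulnDr muln1 leq_add //; apply: fib_le.
move=> y z; rewrite !inE => /predU1P[->|yB] /predU1P[->|zB] //.
- by move=> e; have := BF _ zB; rewrite e eqxx andbF.
- by move=> e; have := BF _ yB; rewrite e eqxx andbF.
exact: phi_inj.
Qed.

Lemma connected_boundary (V : finType) (adj : rel V) (S : {set V}) :
  (forall v w, connect adj v w) -> S != set0 -> S != setT ->
  exists u w, [/\ u \in S, w \notin S & adj u w].
Proof.
move=> conn /set0Pn[v vS] S_T.
have [w wS] : exists w, w \notin S.
  by apply/existsP; apply: contraNT S_T => /existsPn nS; apply/eqP/setP=> w;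
    rewrite inE; apply/negPn.
have /connectP[p] := conn v w.
elim: p v vS => [|y p IHp] v vS /=; first by move=> _ w_v; rewrite w_v vS in wS.
move=> /andP[vy yp] def_w; have [yS|yNS] := boolP (y \in S); first exact: (IHp y).
by exists v, y.
Qed.

(* The exploration of [G] adds one vertex at a time to [S]; each new vertex is
   joined to [S] by an edge, whose value can be chosen in at least [r] ways
   without changing the values on the earlier edges. *)
Lemma separated_assignments (R : numDomainType) (V X : finType) (Y : eqType)
    (adj : rel V) (g : X -> X -> Y) (Gd : {set X}) (r : R) (n : nat) :
  (forall v w, connect adj v w) -> Gd != set0 -> 0 <= r ->
  (forall x, x \in Gd -> exists2 B : {set X}, B \subset Gd &
      {in B &, injective (g x)} /\ r <= #|B|%:R) ->
  (n < #|V|)%N ->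
  exists (S : {set V}) (A : {set {ffun V -> X}}),
    [/\ #|S| = n.+1, forall p, p \in A -> forall v, p v \in Gd,
        forall p q, p \in A -> q \in A -> p != q ->
          exists v w, [/\ v \in S, w \in S, adj v w & g (p v) (p w) != g (q v) (q w)]
      & r ^+ n <= #|A|%:R].
Proof.
move=> conn /set0Pn[x0 x0G] r0 many; elim: n => [|n IHn] lt_n.
  have /card_gt0P[v0 _] := lt_n.
  exists [set v0], [set [ffun=> x0]]; split; rewrite ?cards1 ?expr0 //.
    by move=> p /set1P-> v; rewrite ffunE.
  by move=> p q /set1P-> /set1P->; rewrite eqxx.
have [S [A [cardS A_Gd A_sep cardA]]] := IHn (ltnW lt_n).
have [||u [w [uS wS uw]]] := @connected_boundary V adj S conn.
- by rewrite -card_gt0 cardS.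
- by apply: contraTneq lt_n => S_T; rewrite -cardS S_T cardsT ltnn.
have w_S v : v \in S -> v == w = false by move=> vS; apply: contraNF wS => /eqP<-.
have /fin_all_exists[B B_many] (x : X) : exists B : {set X}, x \in Gd ->
    [/\ B \subset Gd, {in B &, injective (g x)} & r <= #|B|%:R].
  have [xG|xG] := boolP (x \in Gd); last by exists set0.
  by have [B BG [g_inj B_card]] := many x xG; exists B.
pose upd (px : {ffun V -> X} * X) : {ffun V -> X} :=
  [ffun v => if v == w then px.2 else px.1 v].
pose E := [set px : {ffun V -> X} * X | (px.1 \in A) && (px.2 \in B (px.1 u))].
have upd_sep px qy : px \in E -> qy \in E -> px != qy ->
    exists v v', [/\ v \in w |: S, v' \in w |: S, adj v v' &
      g (upd px v) (upd px v') != g (upd qy v) (upd qy v')].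
  case: px qy => [p x] [q y]; rewrite !inE /= => /andP[pA xB] /andP[qA yB].
  (* For p = q the points x and y differ, and the new edge uw separates by injectivity on [B (p u)].
     Otherwise an earlier edge separates: its ends lie in [S], so the update at [w] leaves its
     values unchanged. *)
  move: qA yB; have [<- _ yB|p_q qA yB _] := eqVneq p q.
    rewrite xpair_eqE eqxx /= => x_y; exists u, w.
    rewrite !inE uS eqxx orbT !ffunE w_S //= eqxx; split=> //.
    have [_ g_inj _] := B_many _ (A_Gd p pA u).
    apply: contra_neq x_y; apply: g_inj => //.
  have [v [v' [vS v'S vv' g_neq]]] := A_sep p q pA qA p_q.
  by exists v, v'; rewrite !inE vS v'S !orbT !ffunE !w_S.
exists (w |: S), [set upd px | px in E]; split.
- by rewrite cardsU1 wS cardS.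
- move=> _ /imsetP[[p x] + ->] v; rewrite inE /= => /andP[pA xB]; rewrite ffunE.
  have [BG _ _] := B_many _ (A_Gd p pA u).
  by case: eqP => _ /=; [apply: (subsetP BG)|apply: A_Gd].
- move=> _ _ /imsetP[px pxE ->] /imsetP[qy qyE ->] neq.
  by apply: upd_sep => //; apply: contra_neq neq => ->.
rewrite card_in_imset; last first.
  move=> px qy pxE qyE eq_upd; apply: contraTeq isT => /(upd_sep _ _ pxE qyE).
  by move=> [v [v' [_ _ _]]]; rewrite eq_upd eqxx.
have -> : #|E| = (\sum_(p in A) #|B (p u)|)%N.
  rewrite -sum1_card (eq_bigl _ _ (fun px => in_set _ px)) /=.
  rewrite -(pair_big_dep (mem A) (fun p x => x \in B (p u)) (fun _ _ => 1%N)) /=.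
  by apply: eq_bigr => p _; rewrite sum1_card.
rewrite natr_sum exprS; apply: le_trans (_ : \sum_(p in A) r <= _).
  by rewrite sumr_const -[r *+ _]mulr_natr ler_wpM2l.
by apply: ler_sum => p pA; have [] := B_many _ (A_Gd p pA u).
Qed.

(* [classical_sets] shadows the names [set0], [setT], [subsetT], ... of [finset]. *)
From mathcomp Require Import classical_sets cardinality reals.

(** * Level sets on a curve *)

Section Slices.
Variable R : realType.
Implicit Types (g : {mpoly R[4]}) (p q : R * R) (C : set (R * R)).

Definition slice g p : {mpoly R[2]} :=
  g \mPo [tuple p.1%:MP; p.2%:MP; 'X_ord0; 'X_ord_max].

Lemma eval2_slice g p q : eval2 (slice g p) q = eval4 g p q.
Proof.
rewrite /eval2 /slice comp_mpoly_meval /eval4; apply: meval_eq => i.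
by case: i => [[|[|[|[|//]]]] lt_i]; rewrite !(tnth_nth 0) /= ?mevalC ?mevalXU.
Qed.

(** Only constants and variables are substituted, so no monomial gains degree. *)
Lemma msize_slice g p : (msize (slice g p) <= msize g)%N.
Proof.
rewrite /slice comp_mpolyEX (leq_trans (msize_sum _ _ _)) //.
rewrite big_seq_cond; apply/bigmax_leqP_seq => m _ /andP[m_g _].
rewrite (leq_trans (msizeZ_le _ _)) //; apply: leq_trans (msize_mdeg_lt m_g).
rewrite comp_mpolyX mdegE; apply: (big_ind2 (fun (f : {mpoly R[2]}) k =>
  msize f <= k.+1)%N).
- by rewrite msize1.
- by move=> f k h l f_le h_le; rewrite -addSn msizeM_leq.
move=> i _; set l := tnth _ i; have l_le : (msize l <= 2)%N.
  rewrite /l; case: i {l} => [[|[|[|[|//]]]] lt_i]; rewrite (tnth_nth 0) /=;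
    by rewrite ?msizeC ?msizeX ?mdeg1 // ltnW // ltnS leq_b1.
elim: (m i) => [|k IHk]; first by rewrite expr0 msize1.
by rewrite exprSr -[k.+2]addn1 msizeM_leq.
Qed.

(** On [C], these are the points of the second kind in the outline. *)
Definition separates g C p : Prop :=
  exists x y, [/\ C x, C y & eval4 g p x != eval4 g p y].

(** Bezout's bound is applied to g(p, .) - c and the equation [h] of [C]. Since [h] is prime, a
    common factor would make [h] divide g(p, .) - c, and g(p, .) would be constant on [C]. *)
Lemma level_set_bound g C k p c (s : seq (R * R)) :
    irreducible_curve_of_degree C k -> uniq s -> (forall q, q \in s -> C q) ->
    separates g C p ->
    (forall q, q \in s -> eval4 g p q = c) ->
  (size s <= k * mpdeg g)%N.
Proof.
move=> [_ [h [h_irr def_C h_deg]]] s_uniq s_C [x [y [Cx Cy neq_xy]]] s_c.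
have [h0 _ _] := h_irr; set f := slice g p - c%:MP.
have f_ev q : eval2 f q = eval4 g p q - c.
  by rewrite -eval2_slice /eval2 mevalB mevalC.
have g_gt0 : (0 < msize g)%N.
  rewrite lt0n msize_poly_eq0; apply: contra_neq neq_xy => ->.
  by rewrite /eval4 !meval0.
apply: (@common_zeros_bound _ f h) => //.
- by rewrite -h_deg /mpdeg prednK // lt0n msize_poly_eq0.
- rewrite /mpdeg prednK // (leq_trans (msizeD_le _ _)) // geq_max msize_slice /=.
  by rewrite msizeN msizeC (leq_trans _ g_gt0) // leq_b1.
- move=> a b def_af; have [|//|[z def_f]] := irreducible_mpoly_prime _ def_af.
    exact: h_irr.
  have f_C q : C q -> eval4 g p q = c.
    rewrite def_C => hq; apply/eqP; rewrite -subr_eq0 -f_ev def_f /eval2 mevalM.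
    by rewrite [X in _ * X]hq mulr0.
  by rewrite !f_C // eqxx in neq_xy.
move=> q qs; split; first by rewrite -[LHS]/(eval2 f q) f_ev s_c // subrr.
by have := s_C q qs; rewrite def_C.
Qed.

Lemma not_separates g C p x y : ~ separates g C p -> C x -> C y ->
  eval4 g p x = eval4 g p y.
Proof.
by move=> np Cx Cy; apply: contrapT => /eqP neq; apply: np; exists x, y.
Qed.

Lemma antisymmetric_diag g p : antisymmetric_poly g -> eval4 g p p = 0.
Proof. by move=> /(_ p p)/eqP; rewrite -subr_eq0 opprK -mulr2n mulrn_eq0 => /eqP. Qed.

(** In the symmetric case both values equal g(p, p') = g(p', p); in the antisymmetric case both
    equal the diagonal value 0. *)
Lemma not_separates_eq g C p p' q q' :
  symmetric_poly g \/ antisymmetric_poly g ->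
  ~ separates g C p -> ~ separates g C p' -> C p -> C p' -> C q -> C q' ->
  eval4 g p q = eval4 g p' q'.
Proof.
move=> g_sym np np' Cp Cp' Cq Cq'; case: g_sym => g_sym.
  rewrite (not_separates np Cq Cp') g_sym; exact: not_separates np' _ _.
rewrite (not_separates np Cq Cp) (not_separates np' Cq' Cp').
by rewrite !antisymmetric_diag.
Qed.

Lemma not_separates_bound g C k (s : seq (R * R)) :
    symmetric_poly g \/ antisymmetric_poly g ->
    irreducible_curve_of_degree C k -> ~ constant_on_square g C ->
    uniq s -> (forall q, q \in s -> C q) ->
    (forall q, q \in s -> ~ separates g C q) ->
  (size s <= k * mpdeg g)%N.
Proof.
move=> g_sym C_irr g_ncst s_uniq s_C s_bad.
case: s s_uniq s_C s_bad => // p0 s s_uniq s_C s_bad.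
have p0_s : p0 \in p0 :: s by rewrite mem_head.
(* If no point of [C] separated, [not_separates_eq] would make g constant on the square of [C]. *)
have [q [Cq q_sep]] : exists q, C q /\ separates g C q.
  apply: contrapT => none; apply: g_ncst; exists (eval4 g p0 p0) => p q Cp Cq.
  apply: (@not_separates_eq _ C) => //; try exact: s_C; last exact: s_bad.
  by move=> p_sep; apply: none; exists p.
(* The sign [eps] treats both symmetries at once and puts all of [s] in a single level set of g(q,
   .). *)
have [eps g_eps] : exists eps : R, forall p p', eval4 g p p' = eps * eval4 g p' p.
  by case: g_sym => e; [exists 1|exists (-1)] => p p'; rewrite e ?mul1r ?mulN1r.
apply: (@level_set_bound g C k q (eps * eval4 g p0 q)) => //.
move=> p p_s; rewrite g_eps; congr (_ * _).
by apply: (@not_separates_eq _ C) => //; try exact: s_C; exact: s_bad.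
Qed.

Lemma nonconstant_mpdeg g C : ~ constant_on_square g C -> (0 < mpdeg g)%N.
Proof.
move=> g_ncst; rewrite lt0n; apply/negP => /eqP g0; apply: g_ncst.
have /msize1_polyC -> : (msize g <= 1)%N by move: g0; rewrite /mpdeg; lia.
by exists g@_0%MM => p q _ _; rewrite /eval4 mevalC.
Qed.

End Slices.

(** * The measurement map *)

Section MeasurementImage.
Variables (R : realType) (d : Order.disp_t) (V : finOrderType d) (adj : rel V).
Implicit Types (g : {mpoly R[4]}) (C : set (R * R)) (P : {fset R * R}).

Lemma measurement_image_gt0 g P : P != fset0 ->
  (0 < #|` measurement_image adj g P|)%N.
Proof.
case/fset0Pn => p pP; rewrite cardfs_gt0; apply/fset0Pn.
exists (measurement adj g (fun v => val ([ffun _ : V => [` pP]%fset] v))).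
by apply/imfsetP; exists [ffun _ : V => [` pP]%fset].
Qed.

(** When w < v the stored edge is (w, v); reversing it changes the values at [p] and [q] by the same
    sign, so they still differ. *)
Lemma measurement_separates g (p q : V -> R * R) v w :
  simple_graph adj -> symmetric_poly g \/ antisymmetric_poly g ->
  adj v w -> eval4 g (p v) (p w) != eval4 g (q v) (q w) ->
  measurement adj g p != measurement adj g q.
Proof.
move=> [adj_sym adj_irr] g_sym vw; apply: contra_neq => /ffunP meas_eq.
have lt_eq u t : (u < t)%O -> adj u t ->
    eval4 g (p u) (p t) = eval4 g (q u) (q t).
  move=> lt_ut ut; have e_ok : (u < t)%O && adj u t by rewrite lt_ut.
  by have := meas_eq (exist _ (u, t) e_ok : edge adj); rewrite !ffunE.
case: (ltgtP v w) vw => [lt_vw|lt_wv|->] vw; first exact: lt_eq.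
  by case: g_sym => e; rewrite e [RHS]e (lt_eq _ _ lt_wv) // adj_sym.
by rewrite adj_irr in vw.
Qed.

(** A bound without floors, from which both claims of the theorem follow. With b = D * deg g, the
    base is (|P| - b) / b, at most |P'| / b as at most b points of [P] fail to separate. *)
Lemma separating_count g C k P D :
    simple_graph adj -> connected_graph adj ->
    symmetric_poly g \/ antisymmetric_poly g ->
    irreducible_curve_of_degree C k -> (0 < D)%N -> (k <= D)%N ->
    (forall p, p \in P -> C p) -> ~ constant_on_square g C ->
  (#|` P| <= D * mpdeg g)%N \/
  (D * mpdeg g < #|` P|)%N /\
  (#|` P|%:R / (D * mpdeg g)%:R - 1) ^+ (#|V| - 1)
    <= #|` measurement_image adj g P|%:R :> R.
Proof.
move=> G_simple [V_gt0 conn] g_sym C_irr D_gt0 le_kD P_C g_ncst; set b := (D * mpdeg g)%N.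
have le_b n : (n <= k * mpdeg g)%N -> (n <= b)%N.
  by move=> le_n; rewrite (leq_trans le_n) // leq_mul2r le_kD orbT.
pose Gd : {set P} := finset (fun x : P => `[< separates g C (val x) >]).
have size_sub (A : {set P}) : size [seq val x | x <- enum A] = #|A|.
  by rewrite size_map -cardE.
have uniq_sub (A : {set P}) : uniq [seq val x | x <- enum A].
  by rewrite map_inj_uniq ?enum_uniq //; exact: val_inj.
have sub_C (A : {set P}) q : q \in [seq val x | x <- enum A] -> C q.
  by case/mapP=> x _ ->; apply: P_C; apply: valP.
have bad_le : (#|~: Gd| <= b)%N.
  rewrite -size_sub; apply: le_b; apply: (@not_separates_bound _ g C) => //.
    exact: sub_C.
  by move=> _ /mapP[x + ->]; rewrite mem_enum !inE => /asboolPn.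
have cardP : (#|Gd| + #|~: Gd| = #|` P|)%N by rewrite cardsC cardfE.
have [|lt_bP] := leqP #|` P| b; [by left|right; split=> //].
have b_gt0 : (0 < b)%N by rewrite muln_gt0 D_gt0 (nonconstant_mpdeg g_ncst).
have bR_gt0 : 0 < b%:R :> R by rewrite ltr0n.
pose r : R := #|Gd|%:R / b%:R.
have r_ge0 : 0 <= r by rewrite divr_ge0 ?ler0n.
have Gd_neq0 : Gd != finset.set0.
  by rewrite -card_gt0; move: lt_bP; rewrite -cardP; lia.
have many x : x \in Gd -> exists2 B : {set P}, B \subset Gd &
    {in B &, injective (fun y => eval4 g (val x) (val y))} /\ r <= #|B|%:R.
  rewrite inE => /asboolP x_sep.
  have [|B BG [g_inj le_B]] :=
      @injective_on_subset _ _ (fun y : P => eval4 g (val x) (val y)) Gd b.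
    move=> c; rewrite -size_sub; apply: le_b.
    apply: (@level_set_bound _ g C k (val x) c) => //; first exact: sub_C.
    by move=> _ /mapP[y + ->]; rewrite mem_enum !inE => /andP[_ /eqP].
  by exists B => //; split=> //; rewrite ler_pdivrMr // -natrM ler_nat mulnC.
have lt_V : (#|V|.-1 < #|V|)%N by rewrite prednK.
have [S [A [cardS A_Gd A_sep cardA]]] :=
  separated_assignments conn Gd_neq0 r_ge0 many lt_V.
have S_T : S = finset.setT.
  by apply/eqP; rewrite eqEcard finset.subsetT cardsT cardS prednK /=.
apply: (@le_trans _ _ (r ^+ (#|V| - 1))).
  rewrite lerXn2r ?nnegrE //.
    by rewrite subr_ge0 ler_pdivlMr // mul1r ler_nat ltnW.
  rewrite lerBlDr -[X in _ + X](@divff _ b%:R) ?gt_eqF // -mulrDl.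
  by rewrite ler_pM2r ?invr_gt0 // -natrD ler_nat -cardP leq_add2l.
rewrite subn1 (le_trans cardA) // ler_nat.
pose F (p : {ffun V -> P}) := measurement adj g (fun v => val (p v)).
have F_inj : {in A &, injective F}.
  move=> p q pA qA; apply: contra_eq => p_q.
  have [v [w [_ _ vw neq]]] := A_sep p q pA qA p_q.
  exact: measurement_separates vw neq.
have -> : #|A| = #|` [fset F p | p in A]%fset|.
  by rewrite card_in_imfset //= -cardE.
apply: fsubset_leq_card; apply/fsubsetP => _ /imfsetP[p _ ->].
by apply/imfsetP; exists p.
Qed.

End MeasurementImage.

(** * The explicit and the uniform lower bounds *)

Theorem theorem1p7 (R : realType) (d : Order.disp_t) (V : finOrderType d)
    (adj : rel V) (g : {mpoly R[4]}) (D : nat)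
    (G_simple : simple_graph adj) (G_connected : connected_graph adj)
    (g_sym : symmetric_poly g \/ antisymmetric_poly g) (D_gt0 : (0 < D)%N) :
  (forall (C : set (R * R)) (k : nat) (P : {fset R * R}),
      irreducible_curve_of_degree C k -> (k <= D)%N ->
      P != fset0 -> (forall p, p \in P -> C p) ->
      ~ constant_on_square g C ->
      ((D * mpdeg g)%:R^-1 *
        (Num.floor ((#|` P|%:R - (D * mpdeg g)%:R) / #|V|%:R : R))%:~R)
        ^+ (#|V| - 1)
      <= #|` measurement_image adj g P|%:R :> R) /\
  (exists c : R, 0 < c /\
    forall (C : set (R * R)) (k : nat) (P : {fset R * R}),
      irreducible_curve_of_degree C k -> (k <= D)%N ->
      P != fset0 -> (forall p, p \in P -> C p) ->
      ~ constant_on_square g C ->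
      c * #|` P|%:R ^+ (#|V| - 1) <= #|` measurement_image adj g P|%:R :> R).
Proof.
set b := (D * mpdeg g)%N; have V_gt0 := G_connected.1.
have VR_ge1 : 1 <= #|V|%:R :> R by rewrite ler1n.
have count := separating_count G_simple G_connected g_sym.
split=> [C k P C_irr le_kD P_neq0 P_C g_ncst|].
  have img_ge1 : 1 <= #|` measurement_image adj g P|%:R :> R.
    by rewrite ler1n measurement_image_gt0.
  have b_gt0 : 0 < b%:R :> R.
    by rewrite ltr0n muln_gt0 D_gt0 (nonconstant_mpdeg g_ncst).
  set x : R := (#|` P|%:R - b%:R) / #|V|%:R.
  have [le_Pb|[lt_bP le_img]] := count C k P D C_irr D_gt0 le_kD P_C g_ncst.
    (* For |P| <= b the floor lies between -b and 0, so the base has absolute value at most 1, which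
       suffices for either parity of the exponent since the image is nonempty. *)
    apply: le_trans (ler_norm _) (le_trans _ img_ge1); rewrite normrX.
    rewrite exprn_ile1 ?normr_ge0 // normrM normfV (gtr0_norm b_gt0) mulrC.
    rewrite ler_pdivrMr // mul1r ler_norml; apply/andP; split.
      rewrite -[- _]/(- (b%:Z)%:~R) -rmorphN ler_int floor_ge_int rmorphN /=.
      rewrite ler_pdivlMr ?(lt_le_trans ltr01) // mulNr lerBrDr.
      rewrite (le_trans _ (ler0n _ _)) // addrC subr_le0 ler_peMr // ltW.
    have x_le0 : x <= 0 by rewrite mulr_le0_ge0 ?invr_ge0 ?ler0n // subr_le0 ler_nat.
    by rewrite (le_trans (floor_le _)) // (le_trans x_le0) // ltW.
  apply: le_trans le_img.
  have x_ge0 : 0 <= x by rewrite divr_ge0 ?ler0n // subr_ge0 ler_nat ltnW.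
  have fl_ge0 : 0 <= (Num.floor x)%:~R :> R by rewrite ler0z floor_ge_int.
  rewrite lerXn2r ?nnegrE ?mulr_ge0 ?invr_ge0 ?ler0n //.
    by rewrite subr_ge0 ler_pdivlMr // mul1r ler_nat ltnW.
  rewrite -[X in _ <= _ - X](@divff _ b%:R) ?gt_eqF // -mulrBl mulrC ler_pM2r ?invr_gt0 //.
  (* As |P| - b >= 0 and |V| >= 1, dividing by |V| and rounding down do not increase it. *)
  rewrite (le_trans (floor_le _)) // ler_pdivrMr ?(lt_le_trans ltr01) //.
  by rewrite ler_peMr // subr_ge0 ler_nat ltnW.
(* This is positive even for b = 0. If |P| <= a, the power of |P| / a is at most 1. If |P| > a, then
   |P| / a <= |P| / b - 1, which amounts to |P| (b + 1) >= b (2 b + 1). *)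
pose a : R := (b.*2.+1)%:R.
have a_gt0 : 0 < a by rewrite ltr0n.
exists (a^-1 ^+ (#|V| - 1)); split; first by rewrite exprn_gt0 // invr_gt0.
move=> C k P C_irr le_kD P_neq0 P_C g_ncst; rewrite -exprMn mulrC.
have b_gt0 : 0 < b%:R :> R.
  by rewrite ltr0n muln_gt0 D_gt0 (nonconstant_mpdeg g_ncst).
have img_ge1 : 1 <= #|` measurement_image adj g P|%:R :> R.
  by rewrite ler1n measurement_image_gt0.
have [le_Pa|lt_aP] := leqP #|` P| b.*2.+1.
  apply: le_trans img_ge1; rewrite exprn_ile1 ?divr_ge0 ?ler0n ?(ltW a_gt0) //.
  by rewrite ler_pdivrMr // mul1r ler_nat.
have [le_Pb|[_ le_img]] := count C k P D C_irr D_gt0 le_kD P_C g_ncst.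
  by move: lt_aP le_Pb; rewrite -/b -addnn; lia.
have aR : a = b%:R + b%:R + 1 by rewrite /a -addnn -natrD -natr1.
have PR : a <= #|` P|%:R by rewrite ler_nat ltnW.
have le_base : #|` P|%:R / a <= #|` P|%:R / b%:R - 1.
  rewrite -[X in _ <= _ - X](@divff _ b%:R) ?gt_eqF // -mulrBl.
  rewrite ler_pdivrMr // mulrAC ler_pdivlMr // aR in PR *.
  by move: PR b_gt0; set p := _%:R; set c := _%:R; nra.
apply: le_trans le_img; rewrite lerXn2r ?nnegrE ?divr_ge0 ?ler0n ?(ltW a_gt0) //.
by apply: le_trans le_base; rewrite divr_ge0 ?ler0n ?(ltW a_gt0).
Qed.
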